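(* Let $t\ge2$ and let $g(z)=\sum_{j=1}^t e^{a_j\cdot z+\beta_j}$ be any exponential sum on $\mathbb{C}^n$, with pairwise distinct $a_j\in\mathbb{R}^n$ and $\beta_j\in\mathbb{C}$. For every real $s>0$ define $g_s(z):=\sum_{j=1}^t e^{a_j\cdot z+s\beta_j}$. Then $$\Delta\!\left(\tfrac1s\,\mathrm{Re}(Z(g_s)),\ \mathrm{Trop}(g)\right)\longrightarrow 0\quad\text{as } s\longrightarrow\infty.$$
   Context: For $a\in\mathbb{R}^n$, $z\in\mathbb{C}^n$, $a\cdot z=\sum_i a_iz_i$. $Z(g)\subset\mathbb{C}^n$ is the set of complex zeros of $g$, and $\mathrm{Re}(Z(g)):=\{(\mathrm{Re}(z_1),\ldots,\mathrm{Re}(z_n)):z\in Z(g)\}\subset\mathbb{R}^n$. For $t\ge 2$ the tropical variety is $\mathrm{Trop}(g):=\{(\mathrm{Re}(z_1),\ldots,\mathrm{Re}(z_n)): z\in\mathbb{C}^n,\ \max_j|e^{a_j\cdot z+\beta_j}|\text{ is attained at at least two distinct } j\}\subset\mathbb{R}^n$. For $U,V\subseteq\mathbb{R}^n$, the Hausdorff distance is $\Delta(U,V):=\max\{\sup_{u\in U}\inf_{v\in V}|u-v|,\ \sup_{v\in V}\inf_{u\in U}|u-v|\}$, with $|\cdot|$ the $\ell_2$-norm, and $\frac1s W:=\{\frac1s w: w\in W\}$. *)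

(* Defs.v *)
From HB Require Import structures.
From mathcomp Require Import all_boot all_order all_algebra.
From mathcomp Require Import complex.
From mathcomp Require Import all_classical all_reals all_analysis.

Set Implicit Arguments.
Unset Strict Implicit.
Unset Printing Implicit Defensive.

Import Order.TTheory GRing.Theory Num.Theory.
Import numFieldNormedType.Exports.

Local Open Scope classical_set_scope.
Local Open Scope ring_scope.
Local Open Scope complex_scope.

Definition cexp (R : realType) (w : R[i]) : R[i] :=
  (expR (complex.Re w) * cos (complex.Im w)) +i*
  (expR (complex.Re w) * sin (complex.Im w)).

Definition dotc (R : realType) (n : nat) (a : 'rV[R]_n) (z : 'rV[R[i]]_n)
    : R[i] :=
  \sum_(i < n) (a 0 i)%:C * z 0 i.

Definition exp_term (R : realType) (n t : nat) (a : 'I_t -> 'rV[R]_n)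
    (b : 'I_t -> R[i]) (j : 'I_t) (z : 'rV[R[i]]_n) : R[i] :=
  cexp (dotc (a j) z + b j).

Definition exp_sum (R : realType) (n t : nat) (a : 'I_t -> 'rV[R]_n)
    (b : 'I_t -> R[i]) (z : 'rV[R[i]]_n) : R[i] :=
  \sum_(j < t) exp_term a b j z.

Definition zero_set (R : realType) (n : nat) (g : 'rV[R[i]]_n -> R[i])
    : set 'rV[R[i]]_n :=
  [set z | g z = 0].

Definition re_set (R : realType) (n : nat) (Z : set 'rV[R[i]]_n)
    : set 'rV[R]_n :=
  [set map_mx (@complex.Re R) z | z in Z].

(* The moduli below are R[i]-valued, but nonnegative reals, on which the order *)
(* of R[i] is the usual one.                                                   *)
Definition max_attained_at (R : realType) (n t : nat) (a : 'I_t -> 'rV[R]_n)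
    (b : 'I_t -> R[i]) (z : 'rV[R[i]]_n) (j : 'I_t) : Prop :=
  forall l : 'I_t, `|exp_term a b l z| <= `|exp_term a b j z|.

Definition trop (R : realType) (n t : nat) (a : 'I_t -> 'rV[R]_n)
    (b : 'I_t -> R[i]) : set 'rV[R]_n :=
  re_set [set z | exists j k : 'I_t,
    [/\ j != k, max_attained_at a b z j & max_attained_at a b z k]].

(* The library norm on 'rV[R]_n is the sup norm. *)
Definition l2norm (R : realType) (n : nat) (x : 'rV[R]_n) : R :=
  Num.sqrt (\sum_(i < n) x 0 i ^+ 2).

Definition hausdorff_dist (R : realType) (n : nat) (U V : set 'rV[R]_n)
    : \bar R :=
  Order.max
    (ereal_sup
       [set ereal_inf [set (l2norm (u - v))%:E | v in V] | u in U])
    (ereal_sup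
       [set ereal_inf [set (l2norm (u - v))%:E | u in U] | v in V]).

Definition scale_set (R : realType) (n : nat) (c : R) (W : set 'rV[R]_n)
    : set 'rV[R]_n :=
  [set c *: w | w in W].

(* Main.v *)
Require Import Defs.
From HB Require Import structures.
From mathcomp Require Import all_boot all_order all_algebra.
From mathcomp Require Import complex.
From mathcomp Require Import all_classical all_reals all_analysis.
From mathcomp Require Import ring lra.

(** The logarithm of the modulus of the [l]-th term at [z] is an affine function
of the real part of [z]: its linear part is [a l], and its constant part is
multiplied by [s] when [b] is.  Hence the tropical variety of the scaled sum is
[s] times that of the original sum ([trop_scale]), and it suffices to bound the
two one-sided distances between real parts of zeros and tropical points by
constants that depend on [a] only: after division by [s] they tend to 0.

A zero is near a tropical point ([zero_near_trop]) because at a zero the largest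
term is at most a fixed multiple of the second largest, so a bounded displacement
makes two terms tie for the maximum.

A tropical point [x] is near a zero ([trop_near_zero]) by reduction to one
variable.  On the complex line through [x] in a direction [v] separating the
frequencies, the sum becomes [F w], a sum of [cexp ((al l)%:C * w + g l)] with
distinct real [al l], two terms of which tie for the maximum on the imaginary
axis.  At bounded distance on each side of that axis there is a vertical line on
which a single term dominates all others together ([gap_point],
[dominant_term]), and convexity forces the two terms to be different.  If [F]
had no zero between these lines, its argument would turn along the boundary of
every rectangle of the strip by zero in total ([turn_grid]).  But the vertical
sides, of height [Y], contribute a difference of about [(al j - al i) * Y],
whereas the horizontal sides nearly cancel when [Y] is an almost period of [F]
([almost_period]).  As [Y] can be taken large, this is a contradiction
([strip_zero]).  Winding is measured on finite grids, by sums of arguments of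
ratios in the right half-plane, so that no continuous logarithm or contour
integral is needed. *)

Set Implicit Arguments.
Unset Strict Implicit.
Unset Printing Implicit Defensive.

Import Order.TTheory GRing.Theory Num.Theory.
Import numFieldNormedType.Exports.

Local Open Scope classical_set_scope.
Local Open Scope ring_scope.
Local Open Scope complex_scope.

Local Notation Re := complex.Re.
Local Notation Im := complex.Im.

(** * The complex exponential *)

Section ComplexExponential.
Variable R : realType.
Implicit Types (w u v : R[i]) (x y : R).

Lemma ReD u v : Re (u + v) = Re u + Re v.
Proof. by case: u v => [? ?] [? ?]. Qed.

Lemma ImD u v : Im (u + v) = Im u + Im v.
Proof. by case: u v => [? ?] [? ?]. Qed.

Lemma ReZ x w : Re (x%:C * w) = x * Re w.
Proof. by case: w => [? ?] /=; rewrite mul0r subr0. Qed.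

Lemma ImZ x w : Im (x%:C * w) = x * Im w.
Proof. by case: w => [? ?] /=; rewrite mul0r addr0. Qed.

Lemma Re_sum (I : finType) (F : I -> R[i]) :
  Re (\sum_i F i) = \sum_i Re (F i).
Proof. exact: (big_morph _ ReD). Qed.

Lemma Im_sum (I : finType) (F : I -> R[i]) :
  Im (\sum_i F i) = \sum_i Im (F i).
Proof. exact: (big_morph _ ImD). Qed.

Lemma Re_sub_lt (u v : R[i]) (x : R) : `|u - v| < x%:C -> `|Re u - Re v| < x.
Proof.
by move=> h; rewrite -ltcR; apply: le_lt_trans h; case: u v => [? ?] [? ?];
  exact: (normc_ge_Re (_ +i* _ - _ +i* _)).
Qed.

Lemma cexpD u v : cexp (u + v) = cexp u * cexp v.
Proof.
case: u v => [a b] [c d]; rewrite /cexp /= expRD cosD sinD.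
by apply/eqP; rewrite eq_complex /=; apply/andP; split; apply/eqP; ring.
Qed.

Lemma norm_cexp w : `|cexp w| = (expR (Re w))%:C.
Proof.
rewrite normc_def /= !exprMn -mulrDr cos2Dsin2 mulr1 sqrtr_sqr.
by rewrite ger0_norm ?expR_ge0.
Qed.

Lemma cexp_neq0 w : cexp w != 0.
Proof.
by rewrite -normr_eq0 norm_cexp; apply: contraTneq (expR_gt0 (Re w)) => -[->]; rewrite ltxx.
Qed.

Lemma cexpB u v : cexp (u - v) = cexp u / cexp v.
Proof. by apply: (mulIf (cexp_neq0 v)); rewrite -cexpD subrK divfK ?cexp_neq0. Qed.

Lemma normc_le_ReIm w : `|w| <= (`|Re w| + `|Im w|)%:C.
Proof.
rewrite normc_def lecR -[leRHS]ger0_norm ?addr_ge0 // -sqrtr_sqr ler_sqrt ?sqr_ge0 //.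
rewrite sqrrD !real_normK ?num_real// lerD2r lerDl.
by rewrite mulrn_wge0 // mulr_ge0.
Qed.

(** Continuity at 0, in the coordinatewise form that the grid estimate of
[strip_zero] uses. *)
Lemma cexp_near0 (e : R) : 0 < e -> exists2 d : R, 0 < d &
  forall w, `|Re w| <= d -> `|Im w| <= d -> `|cexp w - 1| <= e%:C.
Proof.
move=> e0.
(* For [a <= 1], [cexp (a +i* b) - 1] splits into the three errors below, each
   worth a third of [e]. *)
have cE : \forall h \near (0 : R), `|expR 1 * (cos h - 1)| <= e/3.
  have : (fun h => expR 1 * (cos h - 1)) x @[x --> (0:R)] --> (expR 1 * (cos (0 : R) - 1) : R).
    apply: cvgM; first exact: cvg_cst.
    by apply: cvgB; [exact: continuous_cos|exact: cvg_cst].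
  rewrite cos0 subrr mulr0 => /cvgr0_norm_le; apply; lra.
have sE : \forall h \near (0 : R), `|expR 1 * sin h| <= e/3.
  have : (fun h => expR 1 * sin h) x @[x --> (0:R)] --> (expR 1 * sin 0 : R).
    apply: cvgM; [exact: cvg_cst|exact: continuous_sin].
  rewrite sin0 mulr0 => /cvgr0_norm_le; apply; lra.
have eE : \forall h \near (0 : R), `|expR h - 1| <= e/3.
  have : (fun h => expR h - 1) x @[x --> (0:R)] --> (expR 0 - 1 : R).
    by apply: cvgB; [exact: continuous_expR|exact: cvg_cst].
  rewrite expR0 subrr => /cvgr0_norm_le; apply; lra.
have /nbhs_normP[d /= d0 dP] : \forall h \near (0 : R),
    [/\ `|expR 1 * (cos h - 1)| <= e/3, `|expR 1 * sin h| <= e/3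
      & `|expR h - 1| <= e/3].
  by near=> h; split; near: h.
exists (Num.min (d / 2) 1); first by rewrite lt_min divr_gt0 ?ltr01.
move=> [a b] /=; rewrite !le_min => /andP[a1 a2] /andP[b1 b2].
have [|_ _ a3] := dP a; first by rewrite /ball_ /= sub0r normrN; lra.
have [|b3 b4 _] := dP b; first by rewrite /ball_ /= sub0r normrN; lra.
have a4 : `|expR a| <= `|expR 1|.
  by rewrite !ger0_norm ?expR_ge0// ler_expR; exact: le_trans (ler_norm _) a2.
apply: le_trans (normc_le_ReIm _) _; rewrite lecR /= subr0.
have -> : expR a * cos b - 1 = (expR a * (cos b - 1)) + (expR a - 1) by ring.
have := ler_normD (expR a * (cos b - 1)) (expR a - 1).
rewrite !normrM in b3 b4 *.
have := ler_wpM2r (normr_ge0 (cos b - 1)) a4.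
have := ler_wpM2r (normr_ge0 (sin b)) a4.
lra.
Unshelve. all: by end_near. Qed.

End ComplexExponential.

(** * Arguments in the right half-plane and discrete winding *)

Section Argument.
Variable R : realType.
Implicit Types (w u v : R[i]) (x y : R).

(** The principal argument of [u] only when [0 < Re u]; every use is under
that condition, so no branch cut occurs. *)
Definition arg u : R := atan (Im u / Re u).

Lemma arg_bound u : `|arg u| < pi / 2.
Proof. by rewrite ltr_norml atan_gtNpi2 atan_ltpi2. Qed.

Lemma arg_cexp x y : `|y| < pi / 2 -> arg (cexp (x +i* y)) = y.
Proof.
move=> /[!ltr_norml] yb; rewrite /arg /=.
have c0 : cos y != 0 by rewrite gt_eqF // cos_gt0_pihalf.
rewrite -mulf_div divff ?gt_eqF ?expR_gt0 // mul1r.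
by rewrite -[sin y / cos y]/(tan y) tanK // inE /= !in_itv.
Qed.

Lemma Re_cexp_gt0 x y : `|y| < pi / 2 -> 0 < Re (cexp (x +i* y)).
Proof. by move=> /[!ltr_norml] yb; rewrite /= mulr_gt0 ?expR_gt0 ?cos_gt0_pihalf. Qed.

Lemma Re_gt0_cexp u : 0 < Re u -> exists x, u = cexp (x +i* arg u).
Proof.
case: u => [a b] /= a0; exists (ln (Num.sqrt (a ^+ 2 + b ^+ 2))).
have s0 : 0 < Num.sqrt (a ^+ 2 + b ^+ 2).
  by rewrite sqrtr_gt0 ltr_pwDl ?sqr_ge0 ?exprn_gt0.
have a0' : a != 0 by rewrite gt_eqF.
have c0 : 0 < cos (arg (a +i* b)).
  by apply: cos_gt0_pihalf; rewrite -ltr_norml arg_bound.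
have cE : cos (arg (a +i* b)) = a / Num.sqrt (a ^+ 2 + b ^+ 2).
  rewrite /arg cos_atan /=.
  have -> : 1 + (b / a) ^+ 2 = (a ^+ 2 + b ^+ 2) / a ^+ 2.
    by field.
  rewrite sqrtrM ?addr_ge0 ?sqr_ge0 // sqrtrV ?sqr_ge0 // sqrtr_sqr gtr0_norm //.
  by rewrite invfM invrK mulrC.
have sE : sin (arg (a +i* b)) = b / Num.sqrt (a ^+ 2 + b ^+ 2).
  have : tan (arg (a +i* b)) = b / a by rewrite /arg atanK.
  rewrite /tan => /(canRL (mulfVK _)) -> //; last by rewrite gt_eqF.
  by rewrite cE; field; rewrite a0' gt_eqF.
rewrite /cexp /= lnK ?posrE // cE sE.
by congr (_ +i* _); rewrite mulrC mulfVK // gt_eqF.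
Qed.

(** Equal exponentials have equal moduli, hence equal sines and cosines of
their imaginary parts; then [cos (y - y') = 1], i.e. [sin ((y - y') / 2) = 0],
and a half-angle in the open interval from [-pi] to [pi] with zero sine is 0. *)
Lemma cexp_inj_Im x x' y y' : cexp (x +i* y) = cexp (x' +i* y') ->
  `|y - y'| < 2 * pi -> y = y'.
Proof.
move=> E yb.
have Ex : expR x = expR x'.
  by apply: complexI; rewrite -[x]/(Re (x +i* y)) -[x']/(Re (x' +i* y')) -!norm_cexp E.
move: E => [+ +]; rewrite Ex => /mulfI Ec /mulfI Es.
have {}Ec := Ec (lt0r_neq0 (expR_gt0 _)); have {}Es := Es (lt0r_neq0 (expR_gt0 _)).
have : cos (y - y') = 1 by rewrite cosB Ec Es -!expr2 cos2Dsin2.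
move: yb; rewrite (_ : cos (y - y') = 1 - sin ((y - y') / 2) ^+ 2 *+ 2); last first.
  rewrite {1}(_ : y - y' = (y - y') / 2 *+ 2); last by rewrite mulr2n; lra.
  by rewrite cos_mulr2n cos2sin2 mulrnBl; lra.
move=> yb /eqP; rewrite -subr_eq0 addrAC subrr add0r oppr_eq0 mulrn_eq0 /= sqrf_eq0 => /eqP s0.
have /[!ltr_norml] hb : `|(y - y') / 2| < pi.
  by rewrite normrM [`|2^-1|]ger0_norm; lra.
have [h|h|h] := ltgtP ((y - y') / 2) 0; last lra.
- have : 0 < sin (- ((y - y') / 2)) by apply: sin_gt0_pi; lra.
  by rewrite sinN s0 oppr0 ltxx.
- have : 0 < sin ((y - y') / 2) by apply: sin_gt0_pi; lra.
  by rewrite s0 ltxx.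
Qed.

(** The two sums agree modulo [2 * pi] since they are arguments of the same
number, and they differ by less than [4 * (pi / 2)].  This is the only place
where the multivaluedness of the argument is dealt with. *)
Lemma arg_add_eq u v u' v' : 0 < Re u -> 0 < Re v -> 0 < Re u' -> 0 < Re v' ->
  u * v = u' * v' -> arg u + arg v = arg u' + arg v'.
Proof.
move=> /Re_gt0_cexp[x Eu] /Re_gt0_cexp[y Ev] /Re_gt0_cexp[x' Eu'] /Re_gt0_cexp[y' Ev'].
have := arg_bound u; have := arg_bound v.
have := arg_bound u'; have := arg_bound v'.
rewrite {2}Eu {2}Ev {2}Eu' {2}Ev' -!cexpD.
move: (arg u) (arg v) (arg u') (arg v') => a b c d.
rewrite !ltr_norml => ? ? ? ? /cexp_inj_Im; apply; rewrite ltr_norml; lra.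
Qed.

(** The signed change of the argument along a polygonal path whose successive
ratios lie in the right half-plane. *)
Definition turn (u : nat -> R[i]) (N : nat) : R :=
  \sum_(k < N) arg (u k.+1 / u k).

(** Two paths that stay within a right angle of each other turn equally, up to
the angle between them at the ends.  By [arg_add_eq] the angle between
the paths changes at each step by exactly the difference of the two step angles,
so the sum telescopes. *)
Lemma turn_compare (u v : nat -> R[i]) N :
  (forall k, (k < N)%N -> 0 < Re (u k.+1 / u k)) ->
  (forall k, (k < N)%N -> 0 < Re (v k.+1 / v k)) ->
  (forall k, (k <= N)%N -> 0 < Re (u k / v k)) ->
  turn u N - turn v N = arg (u N / v N) - arg (u 0%N / v 0%N).
Proof.
elim: N => [|N IH] Hu Hv Huv; first by rewrite /turn !big_ord0 !subrr.
rewrite /turn !big_ord_recr /= -/(turn u N) -/(turn v N).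
have := IH (fun k h => Hu k (ltnW h)) (fun k h => Hv k (ltnW h)) (fun k h => Huv k (leqW h)).
have : arg (u N.+1 / u N) + arg (u N / v N) = arg (v N.+1 / v N) + arg (u N.+1 / v N.+1).
  have nz (z t : R[i]) : 0 < Re (z / t) -> (z != 0) /\ (t != 0).
    by move=> h; split; apply: contraTneq h => ->; rewrite ?mul0r ?invr0 ?mulr0 ltxx.
  have [u1 u0] := nz _ _ (Hu N (ltnSn _)); have [v1 v0] := nz _ _ (Hv N (ltnSn _)).
  by apply: arg_add_eq; [exact: Hu|exact: Huv|exact: Hv|exact: Huv|field; rewrite u0 v0 v1].
lra.
Qed.

Lemma turn_compare_lt (u v : nat -> R[i]) N :
  (forall k, (k < N)%N -> 0 < Re (u k.+1 / u k)) ->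
  (forall k, (k < N)%N -> 0 < Re (v k.+1 / v k)) ->
  (forall k, (k <= N)%N -> 0 < Re (u k / v k)) ->
  `|turn u N - turn v N| < pi.
Proof.
move=> Hu Hv Huv; rewrite turn_compare //.
have := arg_bound (u N / v N); have := arg_bound (u 0%N / v 0%N).
by rewrite !ltr_norml; lra.
Qed.

(** A discrete argument principle: on a grid fine enough for all neighbouring
values to be within a right angle of each other, the winding along the boundary
is zero.  Each new row is compared with the previous one by [turn_compare]. *)
Lemma turn_grid (G : nat -> nat -> R[i]) N M :
  (forall k r, (k < N)%N -> (r <= M)%N -> 0 < Re (G k.+1 r / G k r)) ->
  (forall k r, (k <= N)%N -> (r < M)%N -> 0 < Re (G k r.+1 / G k r)) ->
  turn (G^~ M) N - turn (G^~ 0%N) N = turn (G N) M - turn (G 0%N) M.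
Proof.
elim: M => [|M IH] Hh Hv; first by rewrite /turn !big_ord0 !subrr.
have := IH (fun k r h h' => Hh k r h (leqW h')) (fun k r h h' => Hv k r h (leqW h')).
have := @turn_compare (G^~ M.+1) (G^~ M) N (fun k h => Hh k _ h (leqnn _))
  (fun k h => Hh k _ h (leqnSn _)) (fun k h => Hv k _ h (ltnSn _)).
rewrite [turn _ M.+1]/turn big_ord_recr /= -/(turn _ M).
by rewrite [turn (G 0%N) M.+1]/turn big_ord_recr /= -/(turn _ M); lra.
Qed.

Lemma Re_div_gt0 u v : `|u - v| < `|v| -> 0 < Re (u / v).
Proof.
move=> h; have v0 : v != 0.
  by rewrite -normr_gt0; apply: le_lt_trans h.
have : `|u / v - 1| < 1%:C.
  have -> : u / v - 1 = (u - v) / v by field.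
  by rewrite normrM normfV ltr_pdivrMr ?normr_gt0 // mul1r.
by move/Re_sub_lt; rewrite /= ltr_norml; lra.
Qed.

End Argument.

(** * Exponential sums in one variable *)

Section LineSum.
Variables (R : realType) (t : nat).
Implicit Types (al rho : 'I_t -> R) (g : 'I_t -> R[i]) (w h : R[i]).

Definition line_sum al g w : R[i] := \sum_(l < t) cexp ((al l)%:C * w + g l).

Lemma norm_line_term (x : R) (c : R[i]) w :
  `|cexp (x%:C * w + c)| = (expR (x * Re w + Re c))%:C.
Proof. by rewrite norm_cexp ReD ReZ. Qed.

(** A bound for the sum of the moduli of the terms on the strip
[`|Re w| <= A]. *)
Definition strip_bound al g (A : R) : R :=
  \sum_(l < t) expR (`|al l| * A + Re (g l)).

Lemma strip_bound_ge0 al g A : 0 <= strip_bound al g A.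
Proof. by apply: sumr_ge0 => l _; rewrite expR_ge0. Qed.

(** Translating by [h] multiplies each term by a factor close to 1.  It is used
both for small [h] (fineness of a grid) and for an almost period [h]. *)
Lemma line_sum_shift al g A (e : R) w h : 0 <= e -> `|Re w| <= A ->
  (forall l, `|cexp ((al l)%:C * h) - 1| <= e%:C) ->
  `|line_sum al g (w + h) - line_sum al g w| <= (e * strip_bound al g A)%:C.
Proof.
move=> e0 wA he; rewrite /line_sum -sumrB (le_trans (ler_norm_sum _ _ _)) //.
rewrite /strip_bound mulr_sumr rmorph_sum /=; apply: ler_sum => l _.
have -> : (al l)%:C * (w + h) + g l = ((al l)%:C * w + g l) + (al l)%:C * h by ring.
rewrite cexpD -[X in _ - X]mulr1 -mulrBr normrM norm_line_term mulrC rmorphM.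
apply: ler_pM => //; first by rewrite ler0c expR_ge0.
rewrite lecR ler_expR lerD2r (le_trans (ler_norm _)) // normrM.
exact: ler_wpM2l.
Qed.

Lemma line_sum_min al g (p q Y : R) : p <= q -> 0 <= Y ->
  (forall x y, p <= x <= q -> line_sum al g (x +i* y) != 0) ->
  exists2 m : R, 0 < m & forall x y, p <= x <= q -> 0 <= y <= Y ->
    m%:C <= `|line_sum al g (x +i* y)|.
Proof.
move=> pq Y0 F0.
pose f (xy : R * R) : R := Re (line_sum al g (xy.1 +i* xy.2)) ^+ 2
  + Im (line_sum al g (xy.1 +i* xy.2)) ^+ 2.
have cf : continuous f.
  have lin (a b : R) (pr : R * R -> R) : continuous pr -> continuous (fun xy => a * pr xy + b).
    move=> cp xy; apply: cvgD; last exact: cvg_cst.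
    by apply: cvgM; [exact: cvg_cst|exact: cp].
  have c1 : continuous (fst : R * R -> R) by move=> xy; exact: cvg_fst.
  have c2 : continuous (snd : R * R -> R) by move=> xy; exact: cvg_snd.
  have fE : f = fun xy =>
      (\sum_(l < t) expR (al l * xy.1 + Re (g l)) * cos (al l * xy.2 + Im (g l))) ^+ 2
     + (\sum_(l < t) expR (al l * xy.1 + Re (g l)) * sin (al l * xy.2 + Im (g l))) ^+ 2.
    apply/funext => -[x y]; rewrite /f /line_sum Re_sum Im_sum.
    by congr (_ ^+ 2 + _ ^+ 2); apply: eq_bigr => l _; rewrite [LHS]/= ReD ImD ReZ ImZ.
  rewrite fE => xy; apply: cvgD.
  - have cs : {for xy, continuous (fun xy => \sum_(l < t)
        expR (al l * xy.1 + Re (g l)) * cos (al l * xy.2 + Im (g l)))}.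
      apply: continuous_big; first exact: add_continuous.
      move=> l _ z; apply: cvgM.
        by apply: continuous_comp; [exact: lin|exact: continuous_expR].
      by apply: continuous_comp; [exact: lin|exact: continuous_cos].
    by rewrite expr2; under eq_fun do rewrite expr2; apply: cvgM; exact: cs.
  - have cs : {for xy, continuous (fun xy => \sum_(l < t)
        expR (al l * xy.1 + Re (g l)) * sin (al l * xy.2 + Im (g l)))}.
      apply: continuous_big; first exact: add_continuous.
      move=> l _ z; apply: cvgM.
        by apply: continuous_comp; [exact: lin|exact: continuous_expR].
      by apply: continuous_comp; [exact: lin|exact: continuous_sin].
    by rewrite expr2; under eq_fun do rewrite expr2; apply: cvgM; exact: cs.
have [] := @compact_EVT_min _ R f (`[p, q] `*` `[0, Y]).
- by exists (p, 0); split; rewrite /= in_itv /= lexx.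
- by apply: compact_setX; exact: segment_compact.
- exact: continuous_subspaceT.
move=> [x0 y0] /set_mem[/= x0pq y0Y] fmin; rewrite !in_itv /= in x0pq y0Y.
exists (Num.sqrt (f (x0, y0))) => [|x y xpq yY].
  rewrite sqrtr_gt0 lt_neqAle addr_ge0 ?sqr_ge0 // andbT eq_sym.
  apply: contra (F0 _ y0 x0pq); rewrite paddr_eq0 ?sqr_ge0 // !sqrf_eq0 => /andP[a b].
  by rewrite eq_complex a b.
rewrite normc_def lecR ler_sqrt ?addr_ge0 ?sqr_ge0 //.
by apply: (fmin (x, y)); apply/mem_set; split; rewrite /= in_itv.
Qed.

(** Dirichlet's pigeonhole argument: among sufficiently many multiples of a
period length at least [Y0], two have all their phases in the same cell of a
fine subdivision of the torus, and the difference of these two multiples almost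
fixes every phase. *)
Lemma almost_period al (Y0 e : R) : 0 < e -> exists2 Y : R, Y0 <= Y &
  forall l, `|cexp ((al l)%:C * (0 +i* Y)) - 1| <= e%:C.
Proof.
move=> e0; pose Z := Num.max Y0 1.
have Z0 : 0 < Z by rewrite lt_max ltr01 orbT.
pose K := (Num.truncn (2 / e)).+1.
have K0 : 0 < K%:R :> R by rewrite ltr0n.
have Ke : 2 / K%:R < e.
  by rewrite ltr_pdivrMr // mulrC -ltr_pdivrMr // truncnS_gt.
have cell (x : R) : -1 <= x <= 1 -> (Num.truncn (K%:R * (x + 1)) < (K * 2).+1)%N.
  move=> /andP[x1 x2]; rewrite truncn_lt_nat; last by apply: mulr_ge0; lra.
  apply: (@le_lt_trans _ _ (K * 2)%:R); last by rewrite ltr_nat.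
  by rewrite natrM ler_wpM2l //; lra.
have cellP (x y : R) : -1 <= x <= 1 -> -1 <= y <= 1 ->
    Num.truncn (K%:R * (x + 1)) = Num.truncn (K%:R * (y + 1)) -> `|x - y| <= K%:R^-1.
  move=> /andP[x1 x2] /andP[y1 y2] E.
  have /andP[] : (Num.truncn (K%:R * (x + 1)))%:R <= K%:R * (x + 1)
      < (Num.truncn (K%:R * (x + 1))).+1%:R.
    by apply: truncn_itv; apply: mulr_ge0; lra.
  have /andP[] : (Num.truncn (K%:R * (y + 1)))%:R <= K%:R * (y + 1)
      < (Num.truncn (K%:R * (y + 1))).+1%:R.
    by apply: truncn_itv; apply: mulr_ge0; lra.
  rewrite -E -natr1 => a b c d.
  rewrite -(ler_pM2l K0) divff ?gt_eqF // -{1}[K%:R]ger0_norm // -normrM ler_norml.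
  by rewrite mulrBr; lra.
have trig (f : R -> R) : (forall x, - 1 <= f x <= 1) ->
    forall x, (Num.truncn (K%:R * (f x + 1)) < (K * 2).+1)%N.
  by move=> H x; exact: cell.
have cb x : -1 <= @cos R x <= 1 by rewrite cos_geN1 cos_le1.
have sb x : -1 <= @sin R x <= 1 by rewrite sin_geN1 sin_le1.
(* The cell of a phase is read off from both its cosine and its sine, which
   avoids reducing angles modulo [2 * pi]. *)
pose c (x : R) := (Ordinal (trig _ cb x), Ordinal (trig _ sb x)).
pose T := {ffun 'I_t -> 'I_(K * 2).+1 * 'I_(K * 2).+1}.
pose f (k : 'I_(#|T|.+1)) : T := [ffun l => c (al l * (k%:R * Z))].
have : ~~ injectiveb f.
  apply/negP => /injectiveP /leq_card; by rewrite card_ord ltnn.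
move=> /injectivePn[k1 [k2 k12 E]].
wlog lt12 : k1 k2 k12 E / (k2 < k1)%N.
  move=> H; have [lt21|lt12|/val_inj eq12] := ltngtP k2 k1.
  - exact: (H k1 k2).
  - by apply: (H k2 k1) => //; rewrite eq_sym.
  - by rewrite eq12 eqxx in k12.
exists ((k1 - k2)%:R * Z).
  apply: (@le_trans _ _ Z); first by rewrite le_max lexx.
  by rewrite -[leLHS]mul1r ler_pM2r // ler1n subn_gt0.
move=> l; rewrite (_ : _ * _ =
  0 +i* (al l * (k1%:R * Z)) - 0 +i* (al l * (k2%:R * Z))); last first.
  rewrite natrB ?(ltnW lt12) //.
  by apply/eqP; rewrite eq_complex /=; apply/andP; split; apply/eqP; ring.
rewrite cexpB -[X in _ - X](@divff _ (cexp (0 +i* (al l * (k2%:R * Z))))) ?cexp_neq0 //.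
rewrite -mulrBl normrM normfV norm_cexp /= expR0 invr1 mulr1.
apply: le_trans (normc_le_ReIm _) _; rewrite lecR /= expR0 !mul1r.
move/ffunP: E => /(_ l); rewrite !ffunE => -[E1 E2].
have := cellP _ _ (cb _) (cb _) E1; have := cellP _ _ (sb _) (sb _) E2.
by lra.
Qed.

End LineSum.

(** * Zeros of one-variable sums in a strip *)

Section LineZero.
Variables (R : realType) (t : nat).
Implicit Types (al rho : 'I_t -> R) (g : 'I_t -> R[i]) (w h : R[i]).

(** The bound [C] is uniform in the constants [rho].  The affine functions
[al l * q + rho l] and [al m * q + rho m] are less than [D] apart only on an
interval of length [2 * D / `|al l - al m|].  Among points spaced by more than
all these lengths, each pair spoils at most one, so with one more point than
pairs some point is good for all pairs. *)
Lemma gap_point al (D : R) (j0 : 'I_t) : injective al -> 0 < D ->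
  exists2 C : R, 0 < C & forall rho, exists2 q, 0 < q <= C &
    exists j, forall l, l != j -> al l * q + rho l + D <= al j * q + rho j.
Proof.
move=> inj_al D0.
pose s (lm : 'I_t * 'I_t) := 2 * D / `|al lm.1 - al lm.2|.
have s0 lm : 0 <= s lm by rewrite divr_ge0 // mulr_ge0 // ltW.
pose h : R := 1 + \sum_lm s lm.
have hs lm : s lm < h.
  rewrite /h (bigD1 lm) //=; have : 0 <= \sum_(i | i != lm) s i by exact: sumr_ge0.
  lra.
have h0 : 0 < h by apply: le_lt_trans (hs (j0, j0)).
pose N := #|{: 'I_t * 'I_t}|.+1.
exists (N%:R * h) => [|rho]; first by rewrite mulr_gt0 ?ltr0n.
pose v (q : R) l := al l * q + rho l.
pose q (r : 'I_N) := r.+1%:R * h.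
have [r rP] : exists r : 'I_N, forall l m, l != m -> D <= `|v (q r) l - v (q r) m|.
  apply: contrapT => /forallNP H.
  have {H}/choice[f fP] : forall r, exists lm : 'I_t * 'I_t, lm.1 != lm.2 /\
      `|v (q r) lm.1 - v (q r) lm.2| < D.
    move=> r; have := H r; move=> /existsNP[l /existsNP[m /not_implyP[lm /negP]]].
    by rewrite -ltNge => ?; exists (l, m).
  have : injective f.
    move=> r1 r2 E; apply: contrapT => r12.
    have [lm d1] := fP r1; have [_ d2] := fP r2; rewrite -E in d2.
    have a0 : 0 < `|al (f r1).1 - al (f r1).2|.
      by rewrite normr_gt0 subr_eq0; apply: contra lm => /eqP/inj_al ->.
    have : `|(al (f r1).1 - al (f r1).2) * (q r1 - q r2)| < 2 * D.
      move: d1 d2; rewrite /v => d1 d2.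
      have -> : (al (f r1).1 - al (f r1).2) * (q r1 - q r2) =
        (al (f r1).1 * q r1 + rho (f r1).1 - (al (f r1).2 * q r1 + rho (f r1).2)) -
        (al (f r1).1 * q r2 + rho (f r1).1 - (al (f r1).2 * q r2 + rho (f r1).2)) by ring.
      by apply: le_lt_trans (ler_normB _ _) _; lra.
    have hq : h <= `|q r1 - q r2|.
      rewrite /q -mulrBl normrM (gtr0_norm h0) -[leLHS]mul1r ler_pM2r //.
      have sep (a b : nat) : (b < a)%N -> 1 <= `|a.+1%:R - b.+1%:R : R|.
        by move=> lt; rewrite -natrB ?ltnS ?(ltnW lt) // ger0_norm // ler1n subn_gt0.
      have [lt|lt|/val_inj/esym//] := ltngtP r2 r1; first exact: sep.
      by rewrite distrC; exact: sep.
    rewrite normrM mulrC -ltr_pdivlMr //.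
    have := hs (f r1); rewrite /s; lra.
  by move/leq_card; rewrite card_ord ltnn.
exists (q r).
  by rewrite /q mulr_gt0 ?ltr0n //= ler_pM2r // ler_nat.
have [j _ jmax] := @arg_maxP _ R _ j0 xpredT (v (q r)) isT.
exists j => l lj; have := rP l j lj; have := jmax l isT; rewrite /v /=.
by move=> ?; rewrite ler0_norm; lra.
Qed.

(** A gap of [ln t.+1] in the exponents makes each other term at most
[1 / t.+1] of the [j]-th one. *)
Lemma dominant_term al g w (j : 'I_t) :
  (forall l, l != j -> al l * Re w + Re (g l) + ln t.+1%:R <= al j * Re w + Re (g j)) ->
  `|line_sum al g w - cexp ((al j)%:C * w + g j)| < `|cexp ((al j)%:C * w + g j)|.
Proof.
move=> H; rewrite /line_sum (bigD1 j) //= addrAC subrr add0r.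
apply: le_lt_trans (ler_norm_sum _ _ _) _.
under eq_bigr do rewrite norm_line_term.
rewrite norm_line_term -rmorph_sum ltcR.
rewrite -(@ltr_pM2l _ t.+1%:R) ?ltr0n // mulr_sumr.
set E := expR (al j * _ + _).
apply: (@le_lt_trans _ _ (\sum_(l < t) E)); last first.
  by rewrite sumr_const card_ord -[ltLHS]mulr_natl ltr_pM2r ?expR_gt0 // ltr_nat.
rewrite [leRHS](bigD1 j) //= ler_wpDl ?expR_ge0 //; apply: ler_sum => l lj.
rewrite -{1}[t.+1%:R]lnK ?posrE ?ltr0n // -expRD ler_expR.
by have := H l lj; lra.
Qed.

(** If a different term dominates on each of two vertical lines, then the strip
between them contains a zero.  Otherwise, over a height [Y], the argument turns
by about [al i * Y] along the left line and [al j * Y] along the right one.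
When [Y] is an almost period, the sum takes nearly the same values at the bottom
and at the top of the rectangle, so the horizontal sides turn nearly
equally.  [turn_grid] then bounds [`|al i - al j| * Y] by [3 * pi], which fails
for large [Y]. *)
Lemma strip_zero al g (p q : R) (i j : 'I_t) : p <= q -> al i != al j ->
  (forall y, `|line_sum al g (p +i* y) - cexp ((al i)%:C * (p +i* y) + g i)|
     < `|cexp ((al i)%:C * (p +i* y) + g i)|) ->
  (forall y, `|line_sum al g (q +i* y) - cexp ((al j)%:C * (q +i* y) + g j)|
     < `|cexp ((al j)%:C * (q +i* y) + g j)|) ->
  exists2 w, p <= Re w <= q & line_sum al g w = 0.
Proof.
move=> pq aij domp domq; apply: contrapT => noz.
have F0 x y : p <= x <= q -> line_sum al g (x +i* y) != 0.
  by move=> xpq; apply/eqP => Fz; apply: noz; exists (x +i* y).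
pose A := `|p| + `|q|.
have xA x : p <= x <= q -> `|x| <= A.
  move=> /andP[px xq]; rewrite /A ler_norml.
  have := ler_norm q; have := ler_norm (- p); rewrite normrN.
  by have := normr_ge0 p; have := normr_ge0 q; lra.
pose B := strip_bound al g A; have B0 : 0 <= B by exact: strip_bound_ge0.
pose u (m : R) := m / (2 * (B + 1)).
have u0 m : 0 < m -> 0 < u m by move=> m0; rewrite divr_gt0 //; lra.
have uB m : 0 < m -> u m * B < m.
  move=> m0; rewrite /u mulrAC ltr_pdivrMr; last lra.
  by rewrite ltr_pM2l //; lra.
have pi0 : 0 < pi :> R := pi_gt0 R.
have [m0 m0_gt0 m0P] := line_sum_min pq (lexx 0) F0.
have aij0 : 0 < `|al i - al j| by rewrite normr_gt0 subr_eq0.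
have [Y Y0 YP] := almost_period al (3 * pi / `|al i - al j|) (u0 _ m0_gt0).
have Ypos : 0 < Y by apply: lt_le_trans Y0; rewrite divr_gt0 //; lra.
(* The minimum [m0] on the bottom side determines [Y]; only then can the minimum
   [m] on the whole rectangle be taken, which determines the mesh. *)
have [m m_gt0 mP] := line_sum_min pq (ltW Ypos) F0.
have [d0 d0_gt0 dP] := cexp_near0 (u0 _ m_gt0).
(* The bound [pi / 4] keeps the rotation of the dominating term over one vertical
   step inside the right half-plane. *)
pose d := Num.min d0 (pi / 4).
have d_gt0 : 0 < d by rewrite lt_min d0_gt0; lra.
pose S := \sum_l `|al l|.
have S0 : 0 <= S by exact: sumr_ge0.
have alS l : `|al l| <= S.
  by rewrite /S (bigD1 l) //= lerDl sumr_ge0.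
pose N := (Num.truncn (S * (q - p + Y) / d)).+1.
have N0 : 0 < N%:R :> R by rewrite ltr0n.
have Nd : S * (q - p + Y) / N%:R <= d.
  by rewrite ler_pdivrMr // [leRHS]mulrC -ler_pdivrMr // ltW // truncnS_gt.
have step l x : 0 <= x <= q - p + Y -> `|al l * (x / N%:R)| <= d.
  move=> /andP[x0 xle]; apply: le_trans Nd; rewrite mulrA normrM normfV [`|N%:R|]gtr0_norm //.
  by rewrite ler_pM2r ?invr_gt0 // normrM (ger0_norm x0) ler_pM.
pose X (k : nat) := p + k%:R * ((q - p) / N%:R).
pose V (r : nat) := r%:R * (Y / N%:R).
have XS k : X k.+1 = X k + (q - p) / N%:R by rewrite /X -natr1; ring.
have VS r : V r.+1 = V r + Y / N%:R by rewrite /V -natr1; ring.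
have X0 : X 0%N = p by rewrite /X mul0r addr0.
have XN : X N = q by rewrite /X; field; rewrite gt_eqF.
have V0 : V 0%N = 0 by rewrite /V mul0r.
have VN : V N = Y by rewrite /V; field; rewrite gt_eqF.
have Xb k : (k <= N)%N -> p <= X k <= q.
  move=> kN; have kN1 : k%:R / N%:R <= 1 :> R by rewrite ler_pdivrMr // mul1r ler_nat.
  rewrite /X mulrCA lerDl mulr_ge0 ?divr_ge0 ?subr_ge0 //= -lerBrDl.
  by rewrite ler_piMr // subr_ge0.
have Vb r : (r <= N)%N -> 0 <= V r <= Y.
  move=> rN; have rN1 : r%:R / N%:R <= 1 :> R by rewrite ler_pdivrMr // mul1r ler_nat.
  by rewrite /V mulrCA mulr_ge0 ?divr_ge0 ?(ltW Ypos) //= ler_piMr // ltW.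
pose G k r := line_sum al g (X k +i* V r).
have close k r x y : (k <= N)%N -> (r <= N)%N -> 0 <= x <= q - p + Y -> 0 <= y <= q - p + Y ->
    0 < Re (line_sum al g ((X k +i* V r) + (x / N%:R +i* (y / N%:R))) / G k r).
  move=> kN rN xb yb; apply: Re_div_gt0; apply: lt_le_trans (mP _ _ (Xb _ kN) (Vb _ rN)).
  apply: (@le_lt_trans _ _ (u m * B)%:C); last by rewrite ltcR uB.
  apply: line_sum_shift; [exact/ltW/u0|exact/xA/Xb|] => l.
  by apply: dP; rewrite ?ReZ ?ImZ;
    (apply: (@le_trans _ _ d); [exact: step|rewrite ge_min lexx]).
have Hh k r : (k < N)%N -> (r <= N)%N -> 0 < Re (G k.+1 r / G k r).
  move=> kN rN; have := close k r (q - p) 0 (ltnW kN) rN.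
  rewrite mul0r (_ : _ + _ = X k.+1 +i* V r); last
    by rewrite XS; congr (_ +i* _); exact: addr0.
  by apply; lra.
have Hv k r : (k <= N)%N -> (r < N)%N -> 0 < Re (G k r.+1 / G k r).
  move=> kN rN; have := close k r 0 Y kN (ltnW rN).
  rewrite mul0r (_ : _ + _ = X k +i* V r.+1); last
    by rewrite VS; congr (_ +i* _); exact: addr0.
  by apply; lra.
have grid := turn_grid Hh Hv.
have hor : `|turn (G^~ N) N - turn (G^~ 0%N) N| < pi.
  apply: turn_compare_lt => k kN; [exact: Hh|exact: Hh|].
  apply: Re_div_gt0.
  apply: lt_le_trans (_ : m0%:C <= _); last first.
    by apply: m0P; [exact: Xb|rewrite V0 lexx].
  apply: (@le_lt_trans _ _ (u m0 * B)%:C); last by rewrite ltcR uB.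
  have -> : G k N = line_sum al g ((X k +i* V 0%N) + (0 +i* Y)).
    by rewrite /G VN V0; congr (line_sum _ _ _);
      apply/eqP; rewrite eq_complex /= addr0 add0r !eqxx.
  by apply: line_sum_shift; [exact/ltW/u0|exact/xA/Xb|].
have ver k l : (k <= N)%N ->
    (forall y, `|line_sum al g (X k +i* y) - cexp ((al l)%:C * (X k +i* y) + g l)|
     < `|cexp ((al l)%:C * (X k +i* y) + g l)|) ->
    `|turn (G k) N - al l * Y| < pi.
  move=> kN dom.
  pose v r := cexp ((al l)%:C * (X k +i* V r) + g l).
  have vS r : v r.+1 / v r = cexp (0 +i* (al l * (Y / N%:R))).
    rewrite -cexpB VS; congr cexp.
    case: (g l) => [ga gb]; apply/eqP; rewrite eq_complex /=.
    by apply/andP; split; apply/eqP; ring.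
  have small : `|al l * (Y / N%:R)| < pi / 2.
    apply: (@le_lt_trans _ _ d); first by apply: step; lra.
    by rewrite gt_min; apply/orP; right; lra.
  have -> : al l * Y = turn v N.
    rewrite /turn; under eq_bigr do rewrite vS arg_cexp //.
    by rewrite sumr_const card_ord -mulr_natl; field; rewrite gt_eqF.
  apply: turn_compare_lt => r rN; first exact: Hv.
  - by rewrite vS; apply: Re_cexp_gt0.
  - by apply: Re_div_gt0; exact: dom.
have v1 := ver 0%N i (leq0n _); rewrite X0 in v1; have {v1} := v1 domp.
have v2 := ver N j (leqnn _); rewrite XN in v2; have {v2} := v2 domq.
move: hor; rewrite grid => h1 h2 h3.
have : `|(al i - al j) * Y| < 3 * pi.
  by rewrite mulrBl; move: h1 h2 h3; rewrite !ltr_norml; lra.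
by rewrite normrM (gtr0_norm Ypos) mulrC -ltr_pdivlMr // ltNge Y0.
Qed.

(** [gap_point], applied on both sides of the imaginary axis, gives lines at
bounded distance on which one term dominates.  The two dominating terms
differ: were both equal to [b], convexity would make [b] the strict maximum on
the axis, where two terms are tied. *)
Lemma line_zero al : injective al ->
  exists2 C : R, 0 <= C & forall g (i j : 'I_t), i != j ->
    (forall l, Re (g l) <= Re (g i)) -> (forall l, Re (g l) <= Re (g j)) ->
    exists2 w, `|Re w| <= C & line_sum al g w = 0.
Proof.
move=> inj_al.
have [j0 _|no] := pickP (fun _ : 'I_t => true); last first.
  by exists 0 => // g i; have := no i.
have al_neq i j : i != j -> al i != al j by apply: contra => /eqP/inj_al ->.
have D0 : 0 < ln t.+1%:R :> R.
  by rewrite ln_gt0 // ltr1n ltnS (leq_ltn_trans _ (ltn_ord j0)).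
have inj_oal : injective (fun l => - al l) by move=> x y /oppr_inj /inj_al.
have [C1 C1_gt0 right] := gap_point j0 inj_al D0.
have [C2 C2_gt0 left] := gap_point j0 inj_oal D0.
exists (C1 + C2) => [|g i j ij imax jmax]; first lra.
have [q /andP[q0 qC] [b bP]] := right (fun l => Re (g l)).
have [p /andP[p0 pC] [a aP]] := left (fun l => Re (g l)).
(* If [k] is maximal at abscissa 0 and [k != b], weighting the gaps at [q] and
   [- p] by [p] and [q] cancels the slopes and contradicts maximality. *)
have ab : a != b.
  apply/eqP => ab; rewrite {}ab in aP.
  have key k : (forall l, Re (g l) <= Re (g k)) -> k = b.
    move=> kmax; apply/eqP; case: (eqVneq k b) => // kb.
    have := ler_wpM2l (ltW p0) (bP _ kb); have := ler_wpM2l (ltW q0) (aP _ kb).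
    have := ler_wpM2l (ltW p0) (kmax b); have := ler_wpM2l (ltW q0) (kmax b).
    have := mulr_gt0 p0 D0; have := mulr_gt0 q0 D0.
    rewrite !mulrDr; lra.
  by move: ij; rewrite (key i imax) (key j jmax) eqxx.
have [|||w wpq w0] := @strip_zero al g (- p) q a b _ (al_neq _ _ ab).
- lra.
- by move=> y; apply: dominant_term => l la /=; have := aP l la; lra.
- by move=> y; apply: dominant_term => l lb /=; have := bP l lb; lra.
by exists w => //; rewrite ler_norml; lra.
Qed.
End LineZero.

(** * Zeros and tropical points in several variables *)

Section Tropical.
Variables (R : realType) (n t : nat).
Implicit Types (a : 'I_t -> 'rV[R]_n) (b : 'I_t -> R[i]).
Implicit Types (x y u v : 'rV[R]_n) (z : 'rV[R[i]]_n).

Definition dotr u v : R := \sum_(i < n) u 0 i * v 0 i.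

Lemma dotrDr u x y : dotr u (x + y) = dotr u x + dotr u y.
Proof. by rewrite -big_split; apply: eq_bigr => i _; rewrite mxE mulrDr. Qed.

Lemma dotrZr u x (c : R) : dotr u (c *: x) = c * dotr u x.
Proof. by rewrite mulr_sumr; apply: eq_bigr => i _; rewrite mxE mulrCA. Qed.

Lemma dotrBl u v x : dotr (u - v) x = dotr u x - dotr v x.
Proof. by rewrite -sumrB; apply: eq_bigr => i _; rewrite !mxE mulrBl. Qed.

Lemma dotrr u : dotr u u = l2norm u ^+ 2.
Proof.
rewrite /l2norm sqr_sqrtr; last by apply: sumr_ge0 => i _; rewrite sqr_ge0.
by apply: eq_bigr => i _; rewrite expr2.
Qed.

Lemma l2norm_ge0 u : 0 <= l2norm u.
Proof. exact: sqrtr_ge0. Qed.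

Lemma l2norm_gt0 u : u != 0 -> 0 < l2norm u.
Proof.
move=> u0; rewrite lt_neqAle l2norm_ge0 andbT eq_sym; apply: contra u0.
rewrite -sqrf_eq0 -dotrr psumr_eq0 => [/allP H|i _]; last by rewrite -expr2 sqr_ge0.
apply/eqP/rowP => i; rewrite mxE; apply/eqP.
by have := H i (mem_index_enum i); rewrite /= mulf_eq0 orbb.
Qed.

Lemma l2normZ (c : R) u : l2norm (c *: u) = `|c| * l2norm u.
Proof.
rewrite /l2norm -sqrtr_sqr -sqrtrM ?sqr_ge0 // mulr_sumr.
by congr Num.sqrt; apply: eq_bigr => i _; rewrite mxE exprMn.
Qed.

(** The logarithm of the modulus of the [l]-th term above the real point [x]. *)
Definition height a b (l : 'I_t) x : R := dotr (a l) x + Re (b l).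

Lemma Re_dotc u z : Re (dotc u z) = dotr u (map_mx (@Re R) z).
Proof. by rewrite Re_sum; apply: eq_bigr => i _; rewrite ReZ mxE. Qed.

Lemma norm_exp_term a b l z :
  `|exp_term a b l z| = (expR (height a b l (map_mx (@Re R) z)))%:C.
Proof. by rewrite norm_cexp ReD Re_dotc. Qed.

Lemma tropP a b x : trop a b x <-> exists j k : 'I_t,
  [/\ j != k, forall l, height a b l x <= height a b j x
     & forall l, height a b l x <= height a b k x].
Proof.
split=> [[z [j [k [jk zj zk]]] <-]|[j [k [jk xj xk]]]].
  exists j, k; split=> // l; [have := zj l|have := zk l];
    by rewrite !norm_exp_term lecR ler_expR.
have zx : map_mx (@Re R) (map_mx (real_complex R) x) = x by apply/rowP => i; rewrite !mxE.
exists (map_mx (real_complex R) x) => //; exists j, k.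
by split=> // l; rewrite !norm_exp_term lecR ler_expR zx.
Qed.

Lemma height_scale a b l (s : R) x :
  height a (fun j => s%:C * b j) l (s *: x) = s * height a b l x.
Proof. by rewrite /height dotrZr ReZ mulrDr. Qed.

Lemma trop_scale a b (s : R) x : 0 < s ->
  trop a (fun j => s%:C * b j) (s *: x) <-> trop a b x.
Proof.
move=> s0; split=> /tropP[j [k [jk jm km]]]; apply/tropP; exists j, k; split=> // l.
- by have := jm l; rewrite !height_scale ler_pM2l.
- by have := km l; rewrite !height_scale ler_pM2l.
- by rewrite !height_scale ler_pM2l.
- by rewrite !height_scale ler_pM2l.
Qed.

(** Moving from [x] in the direction [a k - a j], the [k]-th height gains on the
[j]-th one at speed [l2norm (a k - a j) ^+ 2].  The first height that catches up
with the [j]-th one does so no later than the [k]-th, and at a tropical point. *)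
Lemma trop_on_segment a b x (j k : 'I_t) : injective a -> k != j ->
  (forall l, height a b l x <= height a b j x) ->
  exists2 y, trop a b y &
    l2norm (x - y) <= (height a b j x - height a b k x) / l2norm (a k - a j).
Proof.
move=> inj_a kj jmax; set d := a k - a j.
have d0 : 0 < l2norm d.
  by apply: l2norm_gt0; rewrite subr_eq0; apply: contra kj => /eqP/inj_a ->.
pose s l := dotr (a l - a j) d.
have sk : 0 < s k by rewrite /s dotrr exprn_gt0.
(* [tau l] is the time at which [l] catches up; only [l] with [0 < s l] do. *)
pose tau l := (height a b j x - height a b l x) / s l.
have [m sm taumin] := @arg_minP _ R _ k (fun l => 0 < s l) tau sk.
have tau0 : 0 <= tau m by rewrite divr_ge0 ?(ltW sm) // subr_ge0.
pose y := x + tau m *: d.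
have hy l : height a b j y - height a b l y
    = height a b j x - height a b l x - tau m * s l.
  by rewrite /height /y !dotrDr !dotrZr /s dotrBl; ring.
have hm : height a b m y = height a b j y.
  apply/eqP; rewrite eq_sym -subr_eq0 hy /tau mulfVK ?subrr //.
  by rewrite gt_eqF.
have jm l : height a b l y <= height a b j y.
  rewrite -subr_ge0 hy subr_ge0.
  have [sl|sl] := ltP 0 (s l).
    by rewrite -ler_pdivlMr // taumin.
  by apply: (@le_trans _ _ 0); rewrite ?subr_ge0 // mulr_ge0_le0.
exists y.
  apply/tropP; exists j, m; split=> // [|l]; last by rewrite hm.
  apply: contraTneq sm => <-.
  by rewrite /s subrr /dotr big1 ?ltxx // => i _; rewrite mxE mul0r.
rewrite /y opprD addNKr -scaleNr l2normZ normrN (ger0_norm tau0).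
apply: le_trans (_ : tau k * l2norm d <= _).
  by rewrite ler_pM2r // taumin.
by rewrite /tau /s dotrr expr2 invfM mulrA mulfVK // gt_eqF.
Qed.

(** At a zero no term can dominate, so the two largest heights are within
[ln t.+1] of each other, and [trop_on_segment] applies. *)
Lemma zero_near_trop a : (1 < t)%N -> injective a ->
  exists2 C : R, 0 <= C & forall b z, exp_sum a b z = 0 ->
    exists2 y, trop a b y & l2norm (map_mx (@Re R) z - y) <= C.
Proof.
move=> t1 inj_a.
pose c (jk : 'I_t * 'I_t) : R := ln t.+1%:R / l2norm (a jk.2 - a jk.1).
have c0 jk : 0 <= c jk by rewrite divr_ge0 ?l2norm_ge0 // ln_ge0 // ler1n.
exists (\sum_jk c jk) => [|b z z0]; first exact: sumr_ge0.
set x := map_mx (@Re R) z.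
have [j _ jmax] := @arg_maxP _ R _ (Ordinal (ltnW t1)) xpredT (fun l => height a b l x) isT.
have [k kj kgap] : exists2 k, k != j & height a b j x - height a b k x <= ln t.+1%:R.
  apply: contrapT => H.
  have dom l : l != j ->
      0 * Re (0 : R[i]) + Re (dotc (a l) z + b l) + ln t.+1%:R
      <= 0 * Re (0 : R[i]) + Re (dotc (a j) z + b j).
    move=> lj; rewrite !mul0r !add0r !ReD !Re_dotc -/x -lerBrDl.
    have [//|h] := leP (ln t.+1%:R) (height a b j x - height a b l x).
    by case: H; exists l => //; exact: ltW.
  have := @dominant_term R t (fun=> 0) (fun l => dotc (a l) z + b l) 0 j dom.
  rewrite (_ : line_sum _ _ _ = 0) ?sub0r ?normrN ?ltxx //.
  by rewrite -[RHS]z0; apply: eq_bigr => l _; rewrite mulr0 add0r.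
have [y Ty yd] := trop_on_segment inj_a kj (fun l => jmax l isT).
exists y => //; apply: le_trans yd _.
apply: (@le_trans _ _ (c (j, k))).
  by rewrite ler_wpM2r // invr_ge0 l2norm_ge0.
by rewrite (bigD1 (j, k)) //= lerDl sumr_ge0.
Qed.

(** A vector on the moment curve works: the polynomials whose coefficients are
the entries of the [a j] are pairwise distinct, so their differences have a
common non-root [x], and [dotr (a j)] evaluates the [j]-th polynomial at [x]. *)
Lemma separating_direction a : injective a ->
  exists v, injective (fun l => dotr (a l) v).
Proof.
move=> inj_a.
pose Q : {poly R} :=
  \prod_(jk : 'I_t * 'I_t | jk.1 != jk.2) (rVpoly (a jk.1) - rVpoly (a jk.2)).
have Q0 : Q != 0.
  rewrite prodf_seq_neq0; apply/allP => -[j k] _ /=; apply/implyP => jk.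
  by rewrite subr_eq0; apply: contra jk => /eqP/(can_inj rVpolyK)/inj_a ->.
have [x xQ] : exists x : R, ~~ root Q x.
  apply: contrapT => /forallNP H.
  have allQ : all (root Q) [seq i%:R | i <- iota 0 (size Q)].
    by apply/allP => y _; have /negP := H y; rewrite negbK.
  have := max_poly_roots Q0 allQ; rewrite size_map size_iota ltnn; case/(_ _)/negP => //.
  by rewrite map_inj_uniq ?iota_uniq // => i j /eqP; rewrite eqr_nat => /eqP.
exists (\row_i x ^+ i) => j k E; apply: contrapT => /eqP jk.
have hE l : dotr (a l) (\row_i x ^+ i) = (rVpoly (a l)).[x].
  by rewrite horner_poly; apply: eq_bigr => i _; rewrite valK mxE.
move: xQ; rewrite /root /Q horner_prod => /negP; apply.
apply/prodf_eq0; exists (j, k) => //=.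
by rewrite hornerD hornerN -!hE E subrr.
Qed.

(** Restricting the sum to the complex line through [x] in a separating direction
[v] gives a one-variable sum with distinct frequencies, whose coefficients have
two largest moduli.  The constant of [line_zero] depends only on the
frequencies, hence neither on [b] nor on [x]. *)
Lemma trop_near_zero a : injective a ->
  exists2 C : R, 0 <= C & forall b x, trop a b x ->
    exists2 z, exp_sum a b z = 0 & l2norm (map_mx (@Re R) z - x) <= C.
Proof.
move=> inj_a; have [v inj_v] := separating_direction inj_a.
have [C C0 CP] := line_zero inj_v.
exists (C * l2norm v) => [|b x /tropP[j [k [jk jm km]]]].
  by rewrite mulr_ge0 ?l2norm_ge0.
pose g l := (dotr (a l) x)%:C + b l.
have Reg l : Re (g l) = height a b l x by rewrite ReD.
have [|| w wC w0] := CP g j k jk; first by move=> l; rewrite !Reg.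
  by move=> l; rewrite !Reg.
exists (\row_i ((x 0 i)%:C + (v 0 i)%:C * w)).
  rewrite -[RHS]w0; apply: eq_bigr => l _; congr cexp; rewrite /g addrA; congr (_ + _).
  rewrite /dotc /dotr !rmorph_sum mulr_suml -big_split; apply: eq_bigr => i _.
  by rewrite mxE !rmorphM /= mulrDr mulrA addrC.
rewrite (_ : _ - x = Re w *: v); first by rewrite l2normZ ler_wpM2r ?l2norm_ge0.
by apply/rowP => i; rewrite !mxE ReD ReZ [Re _%:C]/=; ring.
Qed.

End Tropical.

(** * Hausdorff distance *)

Section Hausdorff.
Variables (R : realType) (n : nat).
Implicit Types (U V : set 'rV[R]_n).
Local Open Scope ereal_scope.

Lemma hausdorff_dist_le U V (e : R) :
  (forall u, U u -> exists2 v, V v & (l2norm (u - v) <= e)%R) ->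
  (forall v, V v -> exists2 u, U u & (l2norm (u - v) <= e)%R) ->
  hausdorff_dist U V <= e%:E.
Proof.
move=> UV VU; rewrite /hausdorff_dist ge_max; apply/andP; split.
  apply: ge_ereal_sup => _ [u Uu <-]; have [v Vv uv] := UV u Uu.
  apply: le_trans (_ : (l2norm (u - v))%:E <= _); last by rewrite lee_fin.
  by apply: ereal_inf_lbound; exists v.
apply: ge_ereal_sup => _ [v Vv <-]; have [u Uu uv] := VU v Vv.
apply: le_trans (_ : (l2norm (u - v))%:E <= _); last by rewrite lee_fin.
by apply: ereal_inf_lbound; exists u.
Qed.

(** Without nonemptiness both suprema could be [-oo]. *)
Lemma hausdorff_dist_ge0 U V : V !=set0 -> 0 <= hausdorff_dist U V.
Proof.
move=> [v Vv]; rewrite /hausdorff_dist le_max; apply/orP; right.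
apply: le_trans (_ : ereal_inf [set (l2norm (u - v))%:E | u in U] <= _).
  by apply: le_ereal_inf_tmp => _ [u _ <-]; rewrite lee_fin l2norm_ge0.
by apply: ereal_sup_ubound; exists v.
Qed.

End Hausdorff.

(** * Convergence *)

Theorem corollary1p12 (R : realType) (n t : nat) (ht : (2 <= t)%N)
    (a : 'I_t -> 'rV[R]_n) (b : 'I_t -> R[i]) (ha : injective a) :
  hausdorff_dist
    (scale_set (1 / (s : R))
       (re_set (zero_set (exp_sum a (fun j => s%:C * b j)))))
    (trop a b) @[s --> +oo] --> 0%E.
Proof.
have [C1 C1_ge0 zero_trop] := zero_near_trop ht ha.
have [C2 C2_ge0 trop_zero] := trop_near_zero ha.
have trop_neq0 : trop a b !=set0.
  have [j _ jmax] := @arg_maxP _ R _ (Ordinal (ltnW ht)) xpredT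
    (fun l => height a b l 0) isT.
  have [k kj] : exists k, k != j.
    exists (if j == Ordinal ht then Ordinal (ltnW ht) else Ordinal ht).
    by have [->|] := eqVneq j (Ordinal ht); rewrite // eq_sym.
  by have [y Ty _] := trop_on_segment ha kj (fun l => jmax l isT); exists y.
apply: (@squeeze_cvge _ _ _ _ (fun=> 0%E) _ (fun s : R => ((C1 + C2) / s)%:E)).
(* Both one-sided bounds hold for the coefficients [s%:C * b j] at unit scale;
   [trop_scale] lets everything be divided by [s]. *)
- near=> s; have s0 : 0 < s by near: s; apply: nbhs_pinfty_gt; exact: num_real.
  have sn0 : s != 0 by rewrite gt_eqF.
  rewrite hausdorff_dist_ge0 //=; apply: hausdorff_dist_le.
  + move=> _ [_ [z z0 <-] <-]; have [y Ty yC] := zero_trop _ _ z0.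
    exists (s^-1 *: y).
      by apply: (trop_scale a b (s^-1 *: y) s0).1; rewrite scalerA divff // scale1r.
    rewrite div1r -scalerBr l2normZ gtr0_norm ?invr_gt0 // mulrC ler_pM2r ?invr_gt0 //.
    by apply: le_trans yC _; rewrite lerDl.
  + move=> x Tx; have [z z0 zC] := trop_zero _ _ ((trop_scale a b x s0).2 Tx).
    exists ((1 / s) *: map_mx (@Re R) z).
      by exists (map_mx (@Re R) z) => //; exists z.
    rewrite div1r -{1}[x](scalerK sn0) -scalerBr l2normZ gtr0_norm ?invr_gt0 // mulrC.
    by rewrite ler_pM2r ?invr_gt0 //; apply: le_trans zC _; rewrite lerDr.
- exact: cvg_cst.
- apply: cvg_EFin; first by near=> s.
  apply/cvgr0Pnorm_le => e e0; near=> s.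
  have s0 : 0 < s by near: s; apply: nbhs_pinfty_gt; exact: num_real.
  have se : (C1 + C2) / e <= s by near: s; apply: nbhs_pinfty_ge; exact: num_real.
  rewrite /= ger0_norm ?divr_ge0 ?addr_ge0 ?(ltW s0) // ler_pdivrMr //.
  by rewrite mulrC -ler_pdivrMr.
Unshelve. all: by end_near. Qed.
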